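(* Let $l>0$ and suppose that for any $x\in[-l/2,l/2]$ the Wigner potential $V_w(x,\cdot)$ of $V$ belongs to $H^1(\mathbb{R}_v)$. Then for any $x\in[-l/2,l/2]$ the operator $\mathcal{B}[V]$, given by $$\mathcal{B}[V]f(x,v)=\int_{-\infty}^{\infty}\frac{V_w(x,v-v')-V_w(x,-v')}{v}\,f(x,v')\,dv',$$ is a bounded linear operator from $L^2(\mathbb{R}_v)$ to $L^2(\mathbb{R}_v)$.
   Context: $V:\mathbb{R}\to\mathbb{R}$ is a (measurable) potential. For $x,y\in\mathbb{R}$ put $$D_V(x,y)=V(x+y/2)-V(x-y/2).$$ The Wigner potential is $$V_w(x,v)=\frac{i}{2\pi}\int_{-\infty}^{\infty}D_V(x,y)\,e^{ivy}\,dy,$$ i.e. $V_w(x,\cdot)=i\,\mathcal{F}^{-1}(D_V(x,\cdot))$. Here the Fourier transform and its inverse are $\hat f(y)=\mathcal{F}(f)(y)=\int_{\mathbb{R}} f(v)e^{-ivy}\,dv$ and $\mathcal{F}^{-1}(g)(v)=\frac{1}{2\pi}\int_{\mathbb{R}} g(y)e^{ivy}\,dy$, understood in the sense of $L^2$ functions or tempered distributions where necessary ($D_V(x,\cdot)$ is assumed to define a tempered distribution for each $x\in[-l/2,l/2]$). The variable $x$ acts as a parameter: for fixed $x$, $\mathcal{B}[V]$ acts on functions of the velocity $v$. The subscript in $\mathbb{R}_v$ indicates that the variable is the velocity $v$, and $H^1(\mathbb{R}_v)$ is the usual Sobolev space. *)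

(* Defs.v *)
From HB Require Import structures.
From mathcomp Require Import all_boot all_order all_algebra.
From mathcomp Require Import all_classical all_reals all_analysis.
From mathcomp Require Import complex.

Set Implicit Arguments.
Unset Strict Implicit.
Unset Printing Implicit Defensive.

Import Order.TTheory GRing.Theory Num.Theory.
Import numFieldTopology.Exports numFieldNormedType.Exports.

Local Open Scope classical_set_scope.
Local Open Scope ring_scope.
Local Open Scope complex_scope.

Section ComplexValued.
Context {R : realType}.
Local Notation mu := (@lebesgue_measure R).
Local Notation C := R[i].
Implicit Types f g phi : R -> C.

Definition re_part f : R -> R := fun x => complex.Re (f x).
Definition im_part f : R -> R := fun x => complex.Im (f x).

Definition cnorm (z : C) : R := Num.sqrt (complex.Re z ^+ 2 + complex.Im z ^+ 2).

Definition cis (t : R) : C := cos t +i* sin t.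

Definition cintegrable f : Prop :=
  mu.-integrable setT (EFin \o re_part f) /\
  mu.-integrable setT (EFin \o im_part f).

Definition cintegral f : C :=
  (\int[mu]_(x in setT) re_part f x) +i*
  (\int[mu]_(x in setT) im_part f x).

Definition cderiven (n : nat) f : R -> C := fun x =>
  derive1n n (re_part f) x +i* derive1n n (im_part f) x.

Definition csmooth f : Prop := forall (n : nat) (x : R),
  derivable (derive1n n (re_part f)) x 1 /\
  derivable (derive1n n (im_part f)) x 1.

(* Square-integrable functions themselves, not their classes modulo almost
   everywhere equality. *)
Definition inL2 f : Prop :=
  re_part f \in Lfun mu 2%:E /\ im_part f \in Lfun mu 2%:E.

Definition L2norm f : \bar R := Lnorm mu 2%:E (fun x => (cnorm (f x))%:E).

Definition test_function phi : Prop :=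
  csmooth phi /\ compact (closure [set x | phi x != 0]).

Definition weak_derivative f g : Prop := forall phi, test_function phi ->
  cintegral (fun x => f x * cderiven 1 phi x) =
  - cintegral (fun x => g x * phi x).

Definition inH1 f : Prop :=
  inL2 f /\ exists2 g, inL2 g & weak_derivative f g.

Definition schwartz_values (k n : nat) phi : set R :=
  [set `|y| ^+ k * cnorm (cderiven n phi y) | y in [set: R]].

Definition schwartz phi : Prop :=
  csmooth phi /\ forall k n : nat, has_ubound (schwartz_values k n phi).

Definition schwartz_seminorm (k n : nat) phi : R := sup (schwartz_values k n phi).

(* A functional is given on all of [R -> C]; only its values on Schwartz
   functions are meaningful. *)
Definition tempered_distribution (T : (R -> C) -> C) : Prop :=
  (forall (a : C) phi psi, schwartz phi -> schwartz psi ->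
     T (fun y => a * phi y + psi y) = a * T phi + T psi) /\
  (exists (N : nat) (K : R), forall phi, schwartz phi ->
     cnorm (T phi) <=
       K * \sum_(k < N.+1) \sum_(n < N.+1) schwartz_seminorm k n phi).

(* T is the (unique) continuous extension to Schwartz functions of
   phi |-> \int h phi, phi a test function; h * phi need not be integrable for
   every Schwartz phi. *)
Definition defines_tempered (h : R -> R) (T : (R -> C) -> C) : Prop :=
  [/\ locally_integrable setT h,
      tempered_distribution T &
      forall phi, test_function phi ->
        T phi = cintegral (fun y => (h y)%:C * phi y)].

Definition inv_fourier phi : R -> C := fun v =>
  ((2 * pi)^-1)%:C * cintegral (fun y => phi y * cis (v * y)).

(* <F^-1 T, phi> = <T, F^-1 phi>; the pairing is bilinear, without conjugation. *)
Definition inv_fourier_dist (T : (R -> C) -> C) : (R -> C) -> C :=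
  fun phi => T (inv_fourier phi).

Definition dist_is_function (T : (R -> C) -> C) (w : R -> C) : Prop :=
  forall phi, schwartz phi ->
    cintegrable (fun v => w v * phi v) /\
    T phi = cintegral (fun v => w v * phi v).

(* Operators act on functions; the second clause makes the induced map on
   classes modulo almost everywhere equality well defined. *)
Definition bounded_linear_L2 (B : (R -> C) -> (R -> C)) : Prop :=
  [/\ forall f, inL2 f -> inL2 (B f),
      forall f g, inL2 f -> inL2 g ->
        {ae mu, forall v, f v = g v} -> {ae mu, forall v, B f v = B g v},
      forall (a : C) f g, inL2 f -> inL2 g ->
        {ae mu, forall v, B (fun v' => a * f v' + g v') v = a * B f v + B g v} &
      exists K : R, forall f, inL2 f -> (L2norm (B f) <= K%:E * L2norm f)%E].

End ComplexValued.

Section Wigner.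
Context {R : realType}.
Local Notation mu := (@lebesgue_measure R).

Definition potential_difference (V : R -> R) (x y : R) : R :=
  V (x + y / 2) - V (x - y / 2).

(* [TD] is the tempered distribution D_V(x, .). *)
Definition wigner_potential (TD : (R -> R[i]) -> R[i]) : (R -> R[i]) -> R[i] :=
  fun phi => (0 +i* 1) * inv_fourier_dist TD phi.

(* [w] is V_w(x, .) for a fixed x; the value at v = 0, where [_ / 0 = 0], is
   irrelevant up to null sets. *)
Definition wigner_integrand (w f : R -> R[i]) (v v' : R) : R[i] :=
  (w (v - v') - w (- v')) / v%:C * f v'.

Definition wigner_op (w f : R -> R[i]) (v : R) : R[i] :=
  cintegral (wigner_integrand w f v).

End Wigner.

(* Main.v *)
Require Import Defs.
From mathcomp Require Import all_boot all_order all_algebra.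
From mathcomp Require Import all_classical all_reals all_analysis.
From mathcomp Require Import measurable_realfun complex.
From mathcomp Require Import ring lra.

(** Fix the parameter [x], write [w] for the Wigner potential at [x], and let
    [w'] be its weak derivative.  By Cauchy-Schwarz in the integration variable,
    [|B f (v)|^2 <= k(v) * ||f||^2], where [k(v)] is the square of the norm of
    [v' |-> (w (v - v') - w (- v')) / v], so it suffices that [k] is integrable.
    Two bounds on the norm of a translation difference give this:
    - [||w (v - .) - w (- .)||^2 <= 4 ||w||^2], which controls large [v]
      ([sqnorm_translation_diff_le]);
    - [||w (v - .) - w (- .)||^2 <= v^2 ||w'||^2], which cancels the singularity
      of [1 / v] at the origin ([sqnorm_translation_diff_weak]).
    Together they say [k(v) <= (4 ||w||^2 + ||w'||^2) / (1 + v^2)]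
    ([sqnorm_quotient_kernel]), and the right-hand side has integral
    [(4 ||w||^2 + ||w'||^2) * pi].

    The second bound is where the weak derivative enters.  It is reduced to a
    pointwise estimate, [|w b - w a|^2 <= |b - a| * \int_a^b |w'|^2] at Lebesgue
    points [a], [b] of [w] ([increment_sqr_le]): almost every [v'] makes both
    [- v'] and [v - v'] Lebesgue points, and integrating the estimate over [v']
    with Tonelli's theorem counts each [|w' s|^2] on a set of measure [|v|].
    The pointwise estimate comes from testing the weak derivative against a
    smooth approximation [phi] of the indicator of [[a, b]].  The derivative of
    [phi] is a bump at [a] minus a bump at [b], so [\int w phi'] tends to
    [w a - w b] by Lebesgue differentiation ([mollify_lebesgue]), while
    [\int w' phi] is controlled by Cauchy-Schwarz on [[a, b]].

    Real and imaginary parts are treated separately: the complex operator is a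
    combination of four copies of a real one
    ([cintegral_wigner_integrand]). *)

Import Order.TTheory GRing.Theory Num.Theory.
Import numFieldTopology.Exports numFieldNormedType.Exports.

Local Open Scope classical_set_scope.
Local Open Scope ring_scope.
Local Open Scope complex_scope.

Set Implicit Arguments.
Unset Strict Implicit.
Unset Printing Implicit Defensive.

(** * A class of smooth functions and a smooth step *)

Section SmoothFunctions.
Context {R : realType}.
Implicit Types (f g : R -> R) (x : R).

(** The functions [x^-n e^(-1/x)], extended by [0] to the left of the origin.
    Keeping the whole family, and not just the case [n = 0], makes it stable
    under differentiation up to linear combinations. *)
Definition flat (n : nat) x : R := if 0 < x then x^-1 ^+ n * expR (- x^-1) else 0.

(** A class of functions stable under differentiation, hence made of smooth
    functions.  Membership is syntactic, so smoothness of a concrete function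
    is read off its formula. *)
Inductive elementary : (R -> R) -> Prop :=
| elementary_cst c : elementary (fun=> c)
| elementary_flat n : elementary (flat n)
| elementary_add f g : elementary f -> elementary g ->
    elementary (fun x => f x + g x)
| elementary_mul f g : elementary f -> elementary g ->
    elementary (fun x => f x * g x)
| elementary_inv f : elementary f -> (forall x, f x != 0) ->
    elementary (fun x => (f x)^-1)
| elementary_affine a b f : elementary f -> elementary (fun x => f (a * x + b)).

Lemma flat_ge0 n x : 0 <= flat n x.
Proof.
by rewrite /flat; case: ifPn => // x0; rewrite mulr_ge0 ?expR_ge0// exprn_ge0// invr_ge0 ltW.
Qed.

(** The exponential series bounds [e^(1/x)] below by [x^-(n+2) / (n+2)!].  The
    quadratic bound is what makes [flat n] differentiable at the origin with
    derivative [0], whatever [n]. *)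
Lemma flat_le_sqr n x : flat n x <= n.+2`!%:R * x ^+ 2.
Proof.
rewrite /flat; case: ifPn => [x0|_]; last by rewrite mulr_ge0// sqr_ge0.
have xi0 : 0 < x^-1 by rewrite invr_gt0.
have e0 := expR_gt0 x^-1.
have := expR_ge1Dxn n.+1 (ltW xi0) => h.
have {}h : x^-1 ^+ n.+2 / n.+2`!%:R <= expR x^-1 by apply: le_trans h; rewrite lerDr.
have f0 : 0 < n.+2`!%:R :> R by rewrite ltr0n fact_gt0.
rewrite expRN ler_pdivrMr//.
have -> : x^-1 ^+ n = (x^-1 ^+ n.+2 / n.+2`!%:R) * (n.+2`!%:R * x ^+ 2).
  rewrite mulrA divfK ?gt_eqF// -addn2 exprD -mulrA -exprMn mulVf ?gt_eqF//.
  by rewrite expr1n mulr1.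
by rewrite mulrC ler_pM2l// mulr_gt0// exprn_gt0.
Qed.

Lemma is_derive_flat n x :
  is_derive x 1 (flat n) (- n%:R * flat n.+1 x + flat n.+2 x).
Proof.
have [x0|x0|->] := ltgtP x 0.
- rewrite /flat !ltNge (ltW x0)/= mulr0 addr0.
  apply: (@near_eq_is_derive _ _ _ (cst 0)).
  have : \forall y \near x, y < 0 by exact: lt_nbhsl.
  by apply: filterS => y y0; rewrite ltNge (ltW y0).
- apply: (@near_eq_is_derive R R R (fun y : R => y^-1 ^+ n * expR (- y^-1))).
    have : \forall y \near x, 0 < y by exact: lt_nbhsr.
    by apply: filterS => y y0; rewrite /flat y0.
  have xn0 : id x != 0 by rewrite gt_eqF.
  have dV : is_derive x (1:R) (fun y : R => y^-1) (- x ^- 2).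
    apply: is_derive_eq; first exact: (is_deriveV xn0 (is_derive_id x 1)).
    by rewrite [_ *: _]mulr1.
  have dE : is_derive x (1:R) (fun y : R => expR (- y^-1)) (expR (- x^-1) * x ^- 2).
    have dVN : is_derive x (1:R) (fun y : R => - y^-1) (x ^- 2).
      have := is_deriveN dV; rewrite opprK; exact.
    exact: (@is_derive1_comp _ (@expR R) (fun y => - y^-1) x _ _ (is_derive_expR _) dVN).
  have dX := @is_deriveX _ _ _ n x 1 _ dV.
  have h := is_deriveM dX dE; rewrite exprfctE in h.
  refine (@is_derive_eq _ _ _ _ _ _ _ _ h _).
  rewrite /flat x0 /GRing.scale/=.
  rewrite -exprVn; case: n {dX h} => [|n]; rewrite ?mulr0 ?exprS/=; ring.
- have f0 k : flat k 0 = 0 by rewrite /flat ltxx.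
  rewrite !f0 mulr0 addr0.
  apply/is_derive1_caratheodory; exists (fun z => flat n z / z).
  split; last by rewrite f0 mul0r.
    move=> z; rewrite f0 !subr0; have [->|z0] := eqVneq z 0; first by rewrite f0 mulr0.
    by rewrite divfK.
  rewrite /prop_for /continuous_at f0 mul0r.
  have h : (n.+2`!%:R * `|z|) @[z --> (0:R)] --> (0:R).
    rewrite -[X in _ --> X](mulr0 n.+2`!%:R).
    apply: cvgM; first exact: cvg_cst.
    by rewrite -[X in _ --> X](@normr0 _ R); apply: cvg_norm; exact: cvg_id.
  have hN : (- (n.+2`!%:R * `|z|)) @[z --> (0:R)] --> (0:R).
    by rewrite -[X in _ --> X]oppr0; apply: cvgN.
  apply: squeeze_cvgr hN h; apply: nearW => z.
  rewrite -ler_norml normrM normfV ger0_norm ?flat_ge0//.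
  have [->|z0] := eqVneq z 0; first by rewrite normr0 invr0 !mulr0.
  by rewrite ler_pdivrMr ?normr_gt0// -mulrA -expr2 -normrX ger0_norm ?sqr_ge0// flat_le_sqr.
Qed.

Lemma elementary_derive f : elementary f ->
  exists2 f', elementary f' & forall x, is_derive x 1 f (f' x).
Proof.
elim=> {f} [c|n|f g ef [f' ef' df] eg [g' eg' dg]|f g ef [f' ef' df] eg [g' eg' dg]
  |f ef [f' ef' df] f0|a b f ef [f' ef' df]].
- exists (fun=> 0); first exact: elementary_cst.
  by move=> x; exact: is_derive_cst.
- exists (fun x => - n%:R * flat n.+1 x + flat n.+2 x); last exact: is_derive_flat.
  apply: elementary_add; last exact: elementary_flat.
  by apply: (elementary_mul (elementary_cst _)); exact: elementary_flat.
- exists (fun x => f' x + g' x); first exact: elementary_add.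
  by move=> x; exact: is_deriveD.
- exists (fun x => f x * g' x + g x * f' x).
    by apply: elementary_add; apply: elementary_mul.
  by move=> x; exact: is_deriveM.
- exists (fun x => -1 * ((f x)^-1 * (f x)^-1) * f' x).
    apply: elementary_mul => //; apply: elementary_mul; first exact: elementary_cst.
    by apply: elementary_mul; exact: elementary_inv.
  move=> x; apply: (@is_derive_eq _ _ _ _ _ _ _ _ (is_deriveV (f0 x) (df x))).
  by rewrite /GRing.scale/= -exprVn expr2 mulN1r.
- exists (fun x => f' (a * x + b) * a).
    apply: elementary_mul; last exact: elementary_cst.
    exact: (elementary_affine a b ef').
  move=> x.
  have dab : is_derive x (1:R) (fun y : R => a * y + b) a.
    apply: (@is_derive_eq _ _ _ _ _ _ _ _
      (is_deriveD (is_deriveZ a (is_derive_id x 1)) (is_derive_cst b x 1))).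
    by rewrite [_ *: _]mulr1 addr0.
  exact: (@is_derive1_comp _ f (fun y => a * y + b) x _ _ (df _) dab).
Qed.

Lemma elementary_derive1n f n : elementary f -> elementary (derive1n n f).
Proof.
move=> ef; elim: n => [//|n IHn].
have [g eg dg] := elementary_derive IHn.
rewrite derive1nS (_ : derive1 _ = g)//.
by apply/funext => x; rewrite derive1E; exact/derive_val.
Qed.

Lemma elementary_derivable f n x : elementary f -> derivable (derive1n n f) x 1.
Proof.
by move=> /(elementary_derive1n n)/elementary_derive[g _ /(_ x)] [].
Qed.

Lemma elementary_csmooth f : elementary f -> csmooth (fun x => (f x)%:C).
Proof.
move=> ef n x; split; first exact: (@elementary_derivable f).
apply: (@elementary_derivable (fun=> 0)); exact: elementary_cst.
Qed.


Lemma elementary_continuous f : elementary f -> continuous f.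
Proof.
move=> ef x; have df := @elementary_derivable f 0 x ef.
exact/differentiable_continuous/derivable1_diffP.
Qed.

(** [-1 * x + 1], and not [1 - x], is the affine form in which [elementary] is
    closed. *)
Definition smooth_step x : R := flat 0 x * (flat 0 x + flat 0 (-1 * x + 1))^-1.

Lemma smooth_step_den_gt0 x : 0 < flat 0 x + flat 0 (-1 * x + 1).
Proof.
have flat_gt0 y : 0 < y -> 0 < flat 0 y.
  by move=> y0; rewrite /flat y0 expr0 mul1r expR_gt0.
have [x0|x0] := ltP 0 x; first by rewrite ltr_pwDl ?flat_gt0 ?flat_ge0.
by rewrite ltr_wpDl ?flat_ge0// flat_gt0//; lra.
Qed.

Lemma elementary_smooth_step : elementary smooth_step.
Proof.
apply: elementary_mul; first exact: elementary_flat.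
apply: elementary_inv; last by move=> x; rewrite gt_eqF// smooth_step_den_gt0.
by apply: elementary_add; [|apply: elementary_affine]; exact: elementary_flat.
Qed.

Lemma smooth_step_ge0 x : 0 <= smooth_step x.
Proof. by rewrite mulr_ge0 ?flat_ge0// invr_ge0 ltW// smooth_step_den_gt0. Qed.

Lemma smooth_step_le1 x : smooth_step x <= 1.
Proof. by rewrite ler_pdivrMr ?smooth_step_den_gt0// mul1r lerDl flat_ge0. Qed.

Lemma smooth_step_le0 x : x <= 0 -> smooth_step x = 0.
Proof. by move=> x0; rewrite /smooth_step {1}/flat ltNge x0/= mul0r. Qed.

Lemma smooth_step_ge1 x : 1 <= x -> smooth_step x = 1.
Proof.
move=> x1; have := smooth_step_den_gt0 x; rewrite /smooth_step.
have -> : flat 0 (-1 * x + 1) = 0.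
  by rewrite /flat ifF//; apply/negbTE; rewrite -leNgt; lra.
by rewrite addr0 => h; rewrite mulfV// gt_eqF.
Qed.

Lemma elementary_derive1 f : elementary f -> elementary (derive1 f).
Proof. exact: (@elementary_derive1n _ 1). Qed.

Lemma derive1_smooth_step_out x : x < 0 \/ 1 < x -> derive1 smooth_step x = 0.
Proof.
move=> x01; have [c fc] : exists c : R, \forall y \near x, smooth_step y = c.
  case: x01 => [x0|x1].
  - exists 0; have : \forall y \near x, y < 0 by exact: lt_nbhsl.
    by apply: filterS => y /ltW /smooth_step_le0.
  - exists 1; have : \forall y \near x, 1 < y by exact: lt_nbhsr.
    by apply: filterS => y /ltW /smooth_step_ge1.
rewrite derive1E (@near_eq_derive R R R _ (cst c))//.
exact: derive_cst.
Qed.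

Lemma derive1_smooth_step_bounded :
  exists2 M : R, 0 < M & forall x, `|derive1 smooth_step x| <= M.
Proof.
have cS := elementary_continuous (elementary_derive1 elementary_smooth_step).
have /compact_bounded[M [_ Mb]] : compact (derive1 smooth_step @` `[0, 1]).
  apply: continuous_compact; last exact: segment_compact.
  exact: continuous_subspaceT.
exists (Num.max M 0 + 1); first by rewrite ltr_wpDl// le_max lexx orbT.
move=> x; have MM : M < Num.max M 0 + 1 by rewrite ltr_pwDr// le_max lexx.
have [x0|x0] := ltP x 0.
  by rewrite derive1_smooth_step_out ?normr0; [rewrite addr_ge0// le_max lexx orbT|left].
have [x1|x1] := ltP 1 x.
  by rewrite derive1_smooth_step_out ?normr0; [rewrite addr_ge0// le_max lexx orbT|right].
by apply: (Mb _ MM); exists x => //=; rewrite in_itv/= x0 x1.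
Qed.

End SmoothFunctions.

(** * Square-integrable functions *)

Section SquareIntegrable.
Context {R : realType}.
Local Notation mu := (@lebesgue_measure R).
Implicit Types f g : R -> R.

Definition sqnorm f : \bar R := (\int[mu]_x ((f x) ^+ 2)%:E)%E.

Lemma sqnorm_ge0 f : (0 <= sqnorm f)%E.
Proof. by apply: integral_ge0 => x _; rewrite lee_fin sqr_ge0. Qed.

Lemma measurable_sqr_EFin f : measurable_fun setT f ->
  measurable_fun setT (EFin \o (fun x => f x ^+ 2)).
Proof. by move=> mf; apply/measurable_EFinP; exact: measurable_funX. Qed.

Lemma Lnorm2_sqr f : (Lnorm mu 2%:E (EFin \o f) `^ 2)%E = sqnorm f.
Proof.
rewrite powR_Lnorm//; apply: eq_integral => x _ /=.
by rewrite powR_mulrn// -normrX ger0_norm// sqr_ge0.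
Qed.

(** Trades the real power in the L^2 norm for an ordinary square, which ring
    identities can handle. *)
Lemma Lfun2P f :
  f \in Lfun mu 2%:E <-> measurable_fun setT f /\ (sqnorm f < +oo)%E.
Proof.
split.
  move=> f2; split; first by have := sub_Lfun_mfun f2; rewrite inE.
  have /integrableP[_] := Lfun2_integrable_sqr f2.
  apply: le_lt_trans; rewrite le_eqVlt; apply/orP; left; apply/eqP.
  by apply: eq_integral => x _ /=; rewrite ger0_norm// sqr_ge0.
move=> [mf fy]; rewrite inE; apply/andP; split; rewrite inE//=.
rewrite /finite_norm; apply: (@lty_poweRy _ _ 2) => //.
by rewrite Lnorm2_sqr.
Qed.

Lemma Lfun2_measurable f : f \in Lfun mu 2%:E -> measurable_fun setT f.
Proof. by move=> /Lfun2P[]. Qed.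

Lemma Lfun2_sqnorm f : f \in Lfun mu 2%:E -> sqnorm f = (fine (sqnorm f))%:E.
Proof. by move=> /Lfun2P[_ fy]; rewrite fineK// ge0_fin_numE// sqnorm_ge0. Qed.

Lemma Lfun2_le f (M : \bar R) : measurable_fun setT f ->
  (sqnorm f <= M)%E -> (M < +oo)%E -> f \in Lfun mu 2%:E.
Proof. by move=> mf fM My; apply/Lfun2P; split => //; exact: le_lt_trans My. Qed.

Lemma sqnormD_le f g : measurable_fun setT f -> measurable_fun setT g ->
  (sqnorm (fun x => f x + g x)%R <= 2%:E * sqnorm f + 2%:E * sqnorm g)%E.
Proof.
move=> mf mg; rewrite -!ge0_integralZl//; try exact: measurable_sqr_EFin;
  try by move=> x _; rewrite lee_fin sqr_ge0.
rewrite -ge0_integralD//; last 4 first.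
- by move=> x _; rewrite -EFinM lee_fin mulr_ge0// sqr_ge0.
- by apply: emeasurable_funM; [exact: measurable_cst|exact: measurable_sqr_EFin].
- by move=> x _; rewrite -EFinM lee_fin mulr_ge0// sqr_ge0.
- by apply: emeasurable_funM; [exact: measurable_cst|exact: measurable_sqr_EFin].
apply: ge0_le_integral => //.
- by move=> x _; rewrite lee_fin sqr_ge0.
- by apply: measurable_sqr_EFin; exact: measurable_funD.
- by apply: emeasurable_funD; apply: emeasurable_funM;
    [exact: measurable_cst|exact: measurable_sqr_EFin
    |exact: measurable_cst|exact: measurable_sqr_EFin].
- move=> x _; rewrite -!EFinM -EFinD lee_fin.
  have := sqr_ge0 (f x - g x); nra.
Qed.

Lemma sqnormN f : sqnorm (fun x => - f x) = sqnorm f.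
Proof. by apply: eq_integral => x _; rewrite sqrrN. Qed.

Lemma Lfun2D f g : f \in Lfun mu 2%:E -> g \in Lfun mu 2%:E ->
  (fun x => f x + g x) \in Lfun mu 2%:E.
Proof.
move=> f2 g2; apply: (Lfun2_le _ (sqnormD_le (Lfun2_measurable f2) (Lfun2_measurable g2))).
  by apply: measurable_funD; exact: Lfun2_measurable.
by rewrite (Lfun2_sqnorm f2) (Lfun2_sqnorm g2) -!EFinM -EFinD ltry.
Qed.

Lemma Lfun2N f : f \in Lfun mu 2%:E -> (fun x => - f x) \in Lfun mu 2%:E.
Proof.
move=> f2; apply: (@Lfun2_le _ (sqnorm f)); last by have /Lfun2P[] := f2.
  by apply: measurableT_comp => //; exact: Lfun2_measurable.
by rewrite sqnormN.
Qed.

Lemma Lfun2_mul_integrable f g : f \in Lfun mu 2%:E -> g \in Lfun mu 2%:E ->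
  mu.-integrable setT (EFin \o (fun x => f x * g x)).
Proof. by move=> f2 g2; apply/Lfun1_integrable; exact: Lfun2_mul_Lfun1. Qed.

Lemma cauchy_schwarz_Lfun2 f g : f \in Lfun mu 2%:E -> g \in Lfun mu 2%:E ->
  (((\int[mu]_x (f x * g x)) ^+ 2)%:E <= sqnorm f * sqnorm g)%E.
Proof.
move=> f2 g2; have ifg := Lfun2_mul_integrable f2 g2.
have H : (`|\int[mu]_x (f x * g x)|%:E <=
    Lnorm mu 2%:E (EFin \o f) * Lnorm mu 2%:E (EFin \o g))%E.
  apply: le_trans (@hoelder _ _ _ _ _ _ 2 2 _ _ _ _ _) => //; last 3 first.
  - exact: Lfun2_measurable.
  - exact: Lfun2_measurable.
  - by rewrite [RHS]splitr !div1r.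
  rewrite Lnorm1 EFin_normr_Rintegral//; apply: le_abse_integral => //.
  by case/integrableP: ifg.
rewrite -!Lnorm2_sqr -poweRM ?Lnorm_ge0//.
rewrite (_ : ((_ ^+ 2)%:E) = ((`|\int[mu]_x (f x * g x)|%:E) `^ 2)%E); last first.
  by rewrite poweR_EFin powR_mulrn// -normrX ger0_norm// sqr_ge0.
apply: gt0_ler_poweR => //; rewrite in_itv/= ?leey ?andbT ?lee_fin//.
by rewrite mule_ge0// Lnorm_ge0.
Qed.

Lemma sqnorm_bounded_support f (M a b : R) : measurable_fun setT f ->
  (forall x, `|f x| <= M) -> (forall x, ~ (a <= x <= b) -> f x = 0) ->
  (sqnorm f <= (M ^+ 2)%:E * mu `[a, b])%E.
Proof.
move=> mf fM f0; rewrite -integral_cst// [leRHS]integral_mkcond.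
apply: ge0_le_integral => //.
- by move=> x _; rewrite lee_fin sqr_ge0.
- exact: measurable_sqr_EFin.
- by apply/(measurable_restrictT _ _).1 => //; exact: measurable_cst.
- move=> x _; rewrite patchE; case: ifPn => [_|].
    by rewrite lee_fin -(ger0_norm (sqr_ge0 (f x))) normrX lerXn2r
      ?nnegrE ?fM// (le_trans _ (fM x)).
  by rewrite notin_setE/= in_itv/= => /f0 ->; rewrite expr0n.
Qed.

Lemma Lfun2_bounded_support f (M a b : R) : measurable_fun setT f ->
  (forall x, `|f x| <= M) -> (forall x, ~ (a <= x <= b) -> f x = 0) ->
  f \in Lfun mu 2%:E.
Proof.
move=> mf fM f0; apply: (Lfun2_le mf (sqnorm_bounded_support mf fM f0)).
rewrite lebesgue_measure_itv/=; case: ifPn => _; last by rewrite mule0 ltry.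
by rewrite -EFinB -EFinM ltry.
Qed.

End SquareIntegrable.

(** * Mollification at Lebesgue points *)

Section Mollification.
Context {R : realType}.
Local Notation mu := (@lebesgue_measure R).
Implicit Types (u h K f : R -> R).

Lemma bounded_support_integrable f (M a b : R) : measurable_fun setT f ->
  (forall x, `|f x| <= M) -> (forall x, ~ (a <= x <= b) -> f x = 0) ->
  mu.-integrable setT (EFin \o f).
Proof.
move=> mf fM f0; have f2 := Lfun2_bounded_support mf fM f0.
have i2 : (\1_(`[a, b]%classic) : R -> R) \in Lfun mu 2%:E.
  apply: (@Lfun2_bounded_support _ _ 1 a b) => //.
  - by move=> x; rewrite indicE; case: (_ \in _); rewrite ?normr0 ?normr1.
  - by move=> x xab; rewrite indicE memNset//= in_itv.
have := Lfun2_mul_integrable f2 i2; congr (mu.-integrable _ (EFin \o _)).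
apply/funext => x; rewrite indicE; have [xab|xab] := pselect (`[a, b]%classic x).
  by rewrite mem_set// mulr1.
by rewrite memNset// mulr0 f0//; move: xab => /=; rewrite in_itv.
Qed.

(** Since [K] has mass [1], the error is the integral of [(u - u c) * K], and [K]
    is at most [M / r] on a ball of measure [2 r] and vanishes off it: this
    leaves [2 M] times the mean oscillation of [u] on the ball. *)
Lemma mollify_lebesgue u K (c r M : R) : 0 < r ->
  measurable_fun setT u -> measurable_fun setT K ->
  mu.-integrable setT (EFin \o (fun y => u y * K y)) ->
  (forall y, `|K y| <= M / r) -> (forall y, ~ ball c r y -> K y = 0) ->
  \int[mu]_y K y = 1 ->
  (`|\int[mu]_y (u y * K y) - u c|%:E <= (2 * M)%:E * davg u c r)%E.
Proof.
move=> r0 mu_ mK iuK KM K0 K1.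
have M0 : 0 <= M.
  by have := le_trans (normr_ge0 _) (KM c); rewrite pmulr_lge0// invr_gt0.
have iK : mu.-integrable setT (EFin \o K).
  apply: (@bounded_support_integrable _ (M / r) (c - r) (c + r)) => //.
  move=> x xcr; apply: K0 => /=; rewrite /ball/= => h; apply: xcr.
  by move: h; rewrite ltr_norml => /andP[? ?]; apply/andP; split; lra.
have -> : \int[mu]_y (u y * K y) - u c = \int[mu]_y ((u y - u c) * K y).
  have -> : u c = \int[mu]_y (u c * K y) by rewrite RintegralZl// K1 mulr1.
  rewrite -RintegralB//; last first.
    by rewrite (_ : _ \o _ = (fun y => (u c)%:E * (K y)%:E)%E)//; exact: integrableZl.
  by apply: eq_Rintegral => y _; rewrite RintegralZl// K1 mulr1 mulrBl.
have iD : mu.-integrable setT (EFin \o (fun y => (u y - u c) * K y)).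
  rewrite (_ : _ \o _ = (EFin \o (fun y => u y * K y)%R) \- (fun y => (u c)%:E * (K y)%:E))%E.
    by apply: integrableB => //; exact: integrableZl.
  by apply/funext => y /=; rewrite mulrBl.
rewrite EFin_normr_Rintegral//.
have mball : measurable (ball c r) by exact: measurable_ball.
have mD : measurable_fun setT (fun y => `|(u y - u c)%:E|%E).
  by apply: measurableT_comp => //; apply/measurable_EFinP; exact: measurable_funB.
apply: le_trans (le_abse_integral _ measurableT _) _; first by case/integrableP: iD.
rewrite /davg /iavg lebesgue_measure_ball ?(ltW r0)// inver ifF; last first.
  by rewrite mulrn_eq0/= gt_eqF.
apply: (@le_trans _ _ (\int[mu]_(y in ball c r) ((M / r)%:E * `|(u y - u c)%:E|))%E).
  rewrite [leRHS]integral_mkcond; apply: ge0_le_integral => //.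
  - by apply: measurableT_comp => //; case/integrableP: iD.
  - apply/(measurable_restrictT _ _).1 => //; apply: emeasurable_funM => //.
    exact: measurable_funS mD.
  - move=> y _; rewrite patchE; case: ifPn => [_|].
      by rewrite -EFinM lee_fin normrM mulrC ler_wpM2r.
    by rewrite notin_setE => /K0 /= ->; rewrite mulr0 normr0.
rewrite ge0_integralZl//; [|exact: measurable_funS mD|by rewrite lee_fin divr_ge0// ltW].
rewrite muleA -EFinM (_ : 2 * M / (r *+ 2) = M / r)//.
by field; rewrite gt_eqF.
Qed.

Definition scaled_step (k q x : R) : R := smooth_step (k * x + q).

Lemma elementary_scaled_step k q : elementary (scaled_step k q).
Proof. exact: (elementary_affine k q elementary_smooth_step). Qed.

Lemma derive1_scaled_step k q x :
  derive1 (scaled_step k q) x = derive1 smooth_step (k * x + q) * k.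
Proof.
have dab : is_derive x (1:R) (fun y : R => k * y + q) k.
  apply: (@is_derive_eq _ _ _ _ _ _ _ _
    (is_deriveD (is_deriveZ k (is_derive_id x 1)) (is_derive_cst q x 1))).
  by rewrite [_ *: _]mulr1 addr0.
have [g _ dg] := elementary_derive (@elementary_smooth_step R).
have d := @is_derive1_comp _ smooth_step (fun y => k * y + q) x _ _ (dg _) dab.
rewrite !derive1E (@derive_val _ _ _ _ _ _ _ d).
by rewrite (@derive_val _ _ _ _ _ _ _ (dg _)).
Qed.

Lemma derive1_scaled_step_out k q x : ~ (0 <= k * x + q <= 1) ->
  derive1 (scaled_step k q) x = 0.
Proof.
move=> out; rewrite derive1_scaled_step derive1_smooth_step_out ?mul0r//.
by move/negP: out; rewrite negb_and -!ltNge => /orP[]; [left|right].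
Qed.

Lemma elementary_measurable f : elementary f -> measurable_fun setT f.
Proof. by move=> /elementary_continuous; exact: continuous_measurable_fun. Qed.

(** The step climbs from [0] to [1]; the fundamental theorem of calculus turns
    this into unit mass of the bump [(scaled_step k q)']. *)
Lemma integral_derive1_scaled_step (k q : R) : 0 < k ->
  \int[mu]_y derive1 (scaled_step k q) y = 1.
Proof.
move=> k0; have ek := elementary_scaled_step k q.
have ab : - q / k < (1 - q) / k by rewrite ltr_pM2r ?invr_gt0//; lra.
have cF := elementary_continuous ek.
have FTC : (\int[mu]_(y in `[(- q / k)%R, ((1 - q) / k)%R])
      (derive1 (scaled_step k q) y)%:E
    = (scaled_step k q ((1 - q) / k)%R)%:E - (scaled_step k q (- q / k)%R)%:E)%E.
  apply: continuous_FTC2 => //.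
  - apply: continuous_subspaceT; exact: (elementary_continuous (elementary_derive1 ek)).
  - split.
    + by move=> x _; exact: (@elementary_derivable _ _ 0 x ek).
    + exact: cvg_at_right_filter (cF _).
    + exact: cvg_at_left_filter (cF _).
rewrite /Rintegral (_ : integral _ _ _ =
  (\int[mu]_(y in `[(- q / k)%R, ((1 - q) / k)%R]) (derive1 (scaled_step k q) y)%:E)%E).
  rewrite FTC /scaled_step !mulrA ![k * _]mulrC !mulfK ?gt_eqF//.
  by rewrite subrK addNr smooth_step_ge1// smooth_step_le0// sube0.
rewrite [RHS]integral_mkcond; apply: eq_integral => y _; rewrite patchE.
case: ifPn => //; rewrite notin_setE/= in_itv/= => out.
rewrite derive1_scaled_step_out// => /andP[h1 h2]; apply: out; apply/andP; split.
  by rewrite ler_pdivrMr// mulrC; lra.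
by rewrite ler_pdivlMr// mulrC; lra.
Qed.

End Mollification.

(** * Weak derivatives and increments *)

Section WeakDerivative.
Context {R : realType}.
Local Notation mu := (@lebesgue_measure R).
Implicit Types (u h phi : R -> R).

(** Testing is restricted to elementary functions, which are test functions when
    compactly supported and still contain the smoothed indicators of intervals
    that the increment estimate needs. *)
Definition real_weak_derivative u h : Prop := forall phi (a b : R),
  elementary phi -> (forall x, ~ (a <= x <= b) -> phi x = 0) ->
  \int[mu]_x (u x * derive1 phi x) = - \int[mu]_x (h x * phi x).

Lemma Re_mul_real (z : R[i]) (r : R) : complex.Re (z * r%:C) = complex.Re z * r.
Proof. by case: z => a b /=; rewrite mulr0 subr0. Qed.

Lemma Im_mul_real (z : R[i]) (r : R) : complex.Im (z * r%:C) = complex.Im z * r.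
Proof. by case: z => a b /=; rewrite mulr0 add0r. Qed.

Lemma cintegral_mul_real (f : R -> R[i]) phi :
  cintegral (fun x => f x * (phi x)%:C) =
  (\int[mu]_x (re_part f x * phi x)) +i* (\int[mu]_x (im_part f x * phi x)).
Proof.
by congr (_ +i* _); apply: eq_Rintegral => x _; [exact: Re_mul_real|exact: Im_mul_real].
Qed.

Lemma test_function_elementary phi (a b : R) : elementary phi ->
  (forall x, ~ (a <= x <= b) -> phi x = 0) -> test_function (fun x => (phi x)%:C).
Proof.
move=> ephi phi0; split; first exact: elementary_csmooth.
apply: (@subclosed_compact _ _ `[a, b]); first exact: closed_closure.
  exact: segment_compact.
rewrite -[X in _ `<=` X](_ : closure `[a, b]%classic = _); last first.
  by apply/esym/closure_id; exact: itv_closed.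
apply: closure_subset => x /= px; rewrite in_itv/=; apply: contrapT => /phi0 p0.
by move: px; rewrite p0 eqxx.
Qed.

(** Against a real-valued test function, the complex identity splits into its
    real and imaginary parts. *)
Lemma weak_derivative_real f g : weak_derivative f g ->
  real_weak_derivative (re_part f) (re_part g) /\
  real_weak_derivative (im_part f) (im_part g).
Proof.
move=> fg; suff H phi (a b : R) : elementary phi ->
    (forall x, ~ (a <= x <= b) -> phi x = 0) ->
    \int[mu]_x (re_part f x * derive1 phi x) = - (\int[mu]_x (re_part g x * phi x)) /\
    \int[mu]_x (im_part f x * derive1 phi x) = - \int[mu]_x (im_part g x * phi x).
  by split=> phi a b ephi phi0; have [] := H phi a b ephi phi0.
move=> ephi phi0; have := fg _ (test_function_elementary ephi phi0).
have -> : cderiven 1 (fun x => (phi x)%:C) = fun x => (derive1 phi x)%:C.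
  apply/funext => x; rewrite /cderiven !derive1n1; congr (_ +i* _).
  exact: derive1_cst.
by rewrite !cintegral_mul_real => -[].
Qed.

Lemma lebesgue_pt_near u (c e : R) : lebesgue_pt u c -> 0 < e ->
  \forall r \near 0^'+, (davg u c r < e%:E)%E.
Proof.
move=> uc e0; apply: (uc [set x | (x < e%:E)%E]).
by apply: open_nbhs_nbhs; split; [exact: open_ereal_lt_ereal|rewrite /= lte_fin].
Qed.

Lemma Lfun2_derive1_scaled_step (k q : R) : 0 < k ->
  derive1 (scaled_step k q) \in Lfun mu 2%:E.
Proof.
move=> k0; have [M M0 SM] := @derive1_smooth_step_bounded R.
apply: (@Lfun2_bounded_support _ _ (M * k) (- q / k) ((1 - q) / k)).
- exact: elementary_measurable (elementary_derive1 (elementary_scaled_step k q)).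
- move=> x; rewrite derive1_scaled_step normrM (gtr0_norm k0).
  by rewrite ler_wpM2r// ltW.
- move=> x out; apply: derive1_scaled_step_out => /andP[h1 h2]; apply: out.
  by rewrite ler_pdivrMr// ler_pdivlMr// mulrC; apply/andP; split; lra.
Qed.

(** The bump [(scaled_step k q)'] lives on an interval of length [1 / k]
    containing [c], hence in the ball of radius [2 / k] about [c]. *)
Lemma mollify_scaled_step u (c M k q : R) : u \in Lfun mu 2%:E -> 0 < k ->
  (forall x, `|derive1 smooth_step x| <= M) ->
  0 <= k * c + q <= 1 ->
  (`|\int[mu]_y (u y * derive1 (scaled_step k q) y) - u c|%:E <=
    (4 * M)%:E * davg u c (2 / k))%E.
Proof.
move=> u2 k0 SM /andP[c0 c1].
have r0 : 0 < 2 / k by rewrite divr_gt0.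
rewrite (_ : 4 * M = 2 * (2 * M)); last by ring.
apply: mollify_lebesgue => //.
- exact: Lfun2_measurable.
- exact: (Lfun2_measurable (Lfun2_derive1_scaled_step q k0)).
- exact: (Lfun2_mul_integrable u2 (Lfun2_derive1_scaled_step q k0)).
- move=> y; rewrite derive1_scaled_step normrM (gtr0_norm k0).
  rewrite (_ : 2 * M / (2 / k) = M * k); last by field; rewrite gt_eqF.
  by rewrite ler_wpM2r// ltW.
- move=> y yc; apply: derive1_scaled_step_out => /andP[y0 y1]; apply: yc.
  rewrite /ball/= ltr_pdivlMr// -(gtr0_norm k0) -normrM ltr_norml.
  by apply/andP; split; lra.
- exact: integral_derive1_scaled_step.
Qed.

Lemma derive1_sub (f g : R -> R) (x : R) : derivable f x 1 -> derivable g x 1 ->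
  derive1 (fun y => f y + (-1) * g y) x = derive1 f x - derive1 g x.
Proof.
move=> df dg; rewrite (_ : (fun y => _) = f - g); last first.
  by apply/funext => y; rewrite mulN1r.
by rewrite derive1E deriveB// -!derive1E.
Qed.

Lemma approximate_increment_le (A B I x y e s : R) :
  `|A - x| <= e / 2 -> `|B - y| <= e / 2 -> `|I| <= s -> A - B = - I ->
  `|y - x| <= s + e.
Proof.
rewrite !ler_norml => /andP[? ?] /andP[? ?] /andP[? ?] ?.
by apply/andP; split; lra.
Qed.

(** The test function is [S (k (y - a)) - S (k (y - b) + 1)] with [S] the smooth
    step: it rises just to the right of [a] and falls just to the left of [b],
    so its support stays inside [[a, b]] and no limit has to be taken in
    [\int h phi]. *)
Lemma increment_sqr_lt u h (a b : R) :
  u \in Lfun mu 2%:E -> h \in Lfun mu 2%:E -> real_weak_derivative u h ->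
  lebesgue_pt u a -> lebesgue_pt u b -> a < b ->
  (((u b - u a) ^+ 2)%:E <= (b - a)%:E * \int[mu]_(s in `[a, b]) (h s ^+ 2)%:E)%E.
Proof.
move=> u2 h2 uh ua ub ab.
pose hab x : R := h x * \1_(`[a, b]%classic) x.
have habE : (\int[mu]_(s in `[a, b]) (h s ^+ 2)%:E = sqnorm hab)%E.
  rewrite integral_mkcond; apply: eq_integral => x _; rewrite patchE /hab indicE.
  by case: ifPn => _; rewrite ?mulr1// mulr0 expr0n.
have hab2 : hab \in Lfun mu 2%:E.
  have mh := Lfun2_measurable h2.
  apply: (@Lfun2_le _ _ (sqnorm h)); last by have /Lfun2P[] := h2.
    exact: measurable_funM.
  rewrite -habE; apply: ge0_subset_integral => //.
    exact: measurable_sqr_EFin.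
  by move=> x _; rewrite lee_fin sqr_ge0.
rewrite habE (Lfun2_sqnorm hab2) -EFinM lee_fin.
set Q := (b - a) * _.
have Q0 : 0 <= Q by rewrite mulr_ge0 ?fine_ge0 ?sqnorm_ge0// subr_ge0 ltW.
(* Compare square roots, so that the error [e] enters additively. *)
suff : `|u b - u a| <= Num.sqrt Q.
  move=> H; rewrite -(sqr_sqrtr Q0) -[leLHS]ger0_norm ?sqr_ge0// normrX.
  by rewrite lerXn2r// nnegrE// sqrtr_ge0.
apply/ler_addgt0Pr => e e0.
have [M M0 SM] := @derive1_smooth_step_bounded R.
have d0 : 0 < e / (8 * M) by rewrite divr_gt0// mulr_gt0.
have nr : \forall r \near (0:R)^'+, [/\ (davg u a r < (e / (8 * M))%:E)%E,
    (davg u b r < (e / (8 * M))%:E)%E, 0 < r & r < b - a].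
  near=> r; split; near: r.
  - exact: lebesgue_pt_near.
  - exact: lebesgue_pt_near.
  - exact: nbhs_right_gt.
  - by apply: nbhs_right_lt; rewrite subr_gt0.
have [r [ra rb r0 rab]] := @filter_ex _ _ (at_right_proper_filter (0:R)) _ nr.
(* With this slope the bumps at [a] and [b] fit in balls of radius exactly [r]. *)
pose k := 2 / r; have k0 : 0 < k by rewrite divr_gt0.
have rk : 2 / k = r by rewrite /k; field; rewrite gt_eqF.
have kr : k * r = 2 by rewrite /k divfK ?gt_eqF.
have Ka : `|\int[mu]_y (u y * derive1 (scaled_step k (- (k * a))) y) - u a| <= e / 2.
  rewrite -lee_fin; apply: (le_trans (mollify_scaled_step (c := a) (M := M) _ _ _ _)) => //.
    by rewrite subrr lexx ler01.
  rewrite rk (_ : e / 2 = 4 * M * (e / (8 * M))); last by field; rewrite gt_eqF.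
  by rewrite [leRHS]EFinM lee_pmul2l// ?lte_fin ?mulr_gt0// ltW.
have Kb : `|\int[mu]_y (u y * derive1 (scaled_step k (1 - k * b)) y) - u b| <= e / 2.
  rewrite -lee_fin; apply: (le_trans (mollify_scaled_step (c := b) (M := M) _ _ _ _)) => //.
    by rewrite addrC subrK lexx ler01.
  rewrite rk (_ : e / 2 = 4 * M * (e / (8 * M))); last by field; rewrite gt_eqF.
  by rewrite [leRHS]EFinM lee_pmul2l// ?lte_fin ?mulr_gt0// ltW.
pose phi x := scaled_step k (- (k * a)) x + (-1) * scaled_step k (1 - k * b) x.
have ephi : elementary phi.
  apply: elementary_add; first exact: elementary_scaled_step.
  apply: elementary_mul; first exact: elementary_cst.
  exact: elementary_scaled_step.
have phi0 x : ~ (a <= x <= b) -> phi x = 0.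
  move/negP; rewrite negb_and -!ltNge /phi /scaled_step => /orP[xa|bx].
    by rewrite !smooth_step_le0; [rewrite mulr0 addr0|nra|nra].
  by rewrite !smooth_step_ge1; [rewrite mulr1 subrr|nra|nra].
have phi1 x : `|phi x| <= 1.
  have := smooth_step_ge0 (k * x - k * a); have := smooth_step_le1 (k * x - k * a).
  have := smooth_step_ge0 (k * x + (1 - k * b)); have := smooth_step_le1 (k * x + (1 - k * b)).
  by rewrite /phi /scaled_step ler_norml => *; apply/andP; split; lra.
have mphi := elementary_measurable ephi.
have phi2 := Lfun2_bounded_support mphi phi1 phi0.
have dphi x : derive1 phi x =
    derive1 (scaled_step k (- (k * a))) x - derive1 (scaled_step k (1 - k * b)) x.
  have da := @elementary_derivable _ _ 0 x (elementary_scaled_step k (- (k * a))).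
  have db := @elementary_derivable _ _ 0 x (elementary_scaled_step k (1 - k * b)).
  exact: derive1_sub da db.
have := uh phi a b ephi phi0.
have -> : \int[mu]_x (u x * derive1 phi x) =
   \int[mu]_y (u y * derive1 (scaled_step k (- (k * a))) y) -
   \int[mu]_y (u y * derive1 (scaled_step k (1 - k * b)) y).
  rewrite -RintegralB//; [|exact: (Lfun2_mul_integrable u2 (Lfun2_derive1_scaled_step _ k0))..].
  by apply: eq_Rintegral => x _; rewrite dphi mulrBr.
have -> : \int[mu]_x (h x * phi x) = \int[mu]_x (hab x * phi x).
  apply: eq_Rintegral => x _; rewrite /hab indicE.
  have [xab|xab] := pselect (`[a, b]%classic x); first by rewrite mem_set// mulr1.
  by rewrite phi0 ?mulr0// => xab'; apply: xab; rewrite /= in_itv.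
have : `|\int[mu]_x (hab x * phi x)| <= Num.sqrt Q.
  rewrite -sqrtr_sqr ler_wsqrtr// -lee_fin.
  apply: (le_trans (cauchy_schwarz_Lfun2 hab2 phi2)).
  rewrite /Q mulrC EFinM -(Lfun2_sqnorm hab2) lee_wpmul2l ?sqnorm_ge0//.
  apply: (le_trans (sqnorm_bounded_support mphi phi1 phi0)).
  by rewrite expr1n mul1e lebesgue_measure_itv/= lte_fin ab EFinB.
exact: approximate_increment_le Ka Kb.
Unshelve. all: by end_near. Qed.

(** The segment with endpoints [a] and [b] in either order.  The
    centre-and-radius form treats both orders uniformly and makes measurability
    in [(a, b, s)] immediate. *)
Definition between (a b : R) : set R := [set s | `|s - (a + b) / 2| <= `|b - a| / 2].

Lemma increment_sqr_le u h (a b : R) :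
  u \in Lfun mu 2%:E -> h \in Lfun mu 2%:E -> real_weak_derivative u h ->
  lebesgue_pt u a -> lebesgue_pt u b ->
  (((u b - u a) ^+ 2)%:E <=
    `|b - a|%:E * \int[mu]_(s in between a b) (h s ^+ 2)%:E)%E.
Proof.
move=> u2 h2 uh.
wlog ab : a b / a < b.
  move=> H ua ub; have [ab|ba|<-] := ltgtP a b; first exact: H.
  - rewrite -sqrrN opprB -normrN opprB (_ : between a b = between b a); first exact: H.
    by rewrite /between [a + b]addrC -[`|b - a|]normrN opprB.
  - by rewrite !subrr normr0 expr0n mul0e.
have ba0 : 0 < b - a by rewrite subr_gt0.
move=> ua ub; rewrite (gtr0_norm ba0) (_ : between a b = `[a, b]%classic).
  exact: increment_sqr_lt.
apply/seteqP; split=> s; rewrite /between/= in_itv/= (gtr0_norm ba0) ler_norml.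
  by move=> /andP[? ?]; apply/andP; split; lra.
by move=> /andP[? ?]; apply/andP; split; lra.
Qed.

End WeakDerivative.

(** * Reflection invariance of Lebesgue measure *)

Section Reflection.
Context {R : realType}.
Local Notation mu := (@lebesgue_measure R).
Implicit Types (u h f : R -> R) (v : R).

Lemma measurable_reflect v : measurable_fun setT (fun y : R => v - y).
Proof. exact: measurable_funB. Qed.

Lemma lebesgue_measure_reflect v (A : set R) : measurable A ->
  pushforward mu ((fun y => v - y) : _ -> measurableTypeR R) A = mu A.
Proof.
move=> mA; apply/esym/lebesgue_measure_unique => //=.
  exact: measurable_reflect.
move=> _ _ [[a b]] _ <-.
rewrite /pushforward (_ : _ @^-1` _ = `[v - b, v - a[%classic); last first.
  by apply/seteqP; split=> y /=; rewrite !in_itv/= => /andP[? ?]; apply/andP; split; lra.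
rewrite !lebesgue_measure_itv/= !lte_fin ltrD2l ltrN2.
by case: ifP => // _; rewrite -!EFinB; congr EFin; ring.
Qed.

Lemma ge0_integral_reflect v (f : R -> \bar R) : measurable_fun setT f ->
  (forall x, 0 <= f x)%E -> (\int[mu]_y f (v - y)%R = \int[mu]_y f y)%E.
Proof.
move=> mf f0.
transitivity (\int[pushforward mu
    ((fun y => v - y)%R : _ -> measurableTypeR R)]_(y in setT) f y)%E.
  rewrite ge0_integral_pushforward//; exact: measurable_reflect.
apply: eq_measure_integral => /=; first exact: measurable_reflect.
by move=> mphi A mA _; exact: lebesgue_measure_reflect.
Qed.

Lemma ae_reflect v (P : R -> Prop) :
  {ae mu, forall y, P y} -> {ae mu, forall y, P (v - y)}.
Proof.
move=> [N [mN N0 PN]]; exists ((fun y => v - y) @^-1` N); split.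
- by rewrite -[X in measurable X]setTI; exact: measurable_reflect.
- by rewrite -[LHS](lebesgue_measure_reflect v mN) in N0.
- by move=> y /= nP; exact: PN.
Qed.

End Reflection.

(** * Translation differences in L^2 *)

Section Translation.
Context {R : realType}.
Local Notation mu := (@lebesgue_measure R).
Implicit Types (u h f : R -> R) (v : R).

Definition translation_diff u v (y : R) : R := u (v - y) - u (- y).

Lemma measurable_comp_reflect u v : measurable_fun setT u ->
  measurable_fun setT (fun y : R => u (v - y)).
Proof. by move=> mu_; apply: measurableT_comp => //; exact: measurable_reflect. Qed.

Lemma sqnorm_reflect u v : measurable_fun setT u ->
  sqnorm (fun y => u (v - y)) = sqnorm u.
Proof.
move=> mu_; apply: (ge0_integral_reflect v (measurable_sqr_EFin mu_)) => x.
by rewrite lee_fin sqr_ge0.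
Qed.

Lemma Lfun2_reflect u v : u \in Lfun mu 2%:E ->
  (fun y => u (v - y)) \in Lfun mu 2%:E.
Proof.
move=> /Lfun2P[mu_ uy]; apply/Lfun2P; split; first exact: measurable_comp_reflect.
by rewrite sqnorm_reflect.
Qed.

Lemma translation_diffE u v :
  translation_diff u v = fun y => u (v - y) + - u (0 - y).
Proof. by apply/funext => y; rewrite /translation_diff sub0r. Qed.

Lemma Lfun2_translation_diff u v : u \in Lfun mu 2%:E ->
  translation_diff u v \in Lfun mu 2%:E.
Proof.
move=> u2; rewrite translation_diffE; apply: Lfun2D; first exact: Lfun2_reflect.
by apply: Lfun2N; exact: Lfun2_reflect.
Qed.

Lemma sqnorm_translation_diff_le u v : u \in Lfun mu 2%:E ->
  (sqnorm (translation_diff u v) <= 4%:E * sqnorm u)%E.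
Proof.
move=> u2; have mu_ := Lfun2_measurable u2.
have mr w := Lfun2_measurable (Lfun2_reflect w u2).
rewrite translation_diffE; apply: le_trans (sqnormD_le (mr v) _) _.
  by apply: measurableT_comp => //; exact: mr.
rewrite (sqnormN (fun y => u (0 - y))) !sqnorm_reflect// (Lfun2_sqnorm u2).
by rewrite -!EFinM -EFinD lee_fin; lra.
Qed.

(** Integrate [increment_sqr_le] with endpoints [- y] and [v - y] over [y].
    After exchanging the integrals, a given [s] lies between [- y] and [v - y]
    for [y] in an interval of length [|v|]. *)
Lemma sqnorm_translation_diff_weak u h v :
  u \in Lfun mu 2%:E -> h \in Lfun mu 2%:E -> real_weak_derivative u h ->
  (sqnorm (translation_diff u v) <= (v ^+ 2)%:E * sqnorm h)%E.
Proof.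
move=> u2 h2 uh; have mh := Lfun2_measurable h2.
(* Cauchy-Schwarz against the indicator of a compact set. *)
have locu : locally_integrable setT u.
  split=> [||K _ cK]; [exact: Lfun2_measurable|exact: openT|].
  have mK : measurable K by exact: compact_measurable.
  have K2 : (\1_K : R -> R) \in Lfun mu 2%:E.
    apply: (@Lfun2_le _ _ (mu K)) => //; last exact: compact_finite_measure.
    have <- : (\int[mu]_x (\1_K x)%:E = mu K)%E by rewrite integral_indic// setIT.
    rewrite /sqnorm.
    by rewrite le_eqVlt; apply/orP; left; apply/eqP; apply: eq_integral => x _;
      rewrite indicE; case: (_ \in _); rewrite ?expr0n ?expr1n.
  have /integrableP[_] := Lfun2_mul_integrable u2 K2.
  apply: le_lt_trans; rewrite le_eqVlt; apply/orP; left; apply/eqP.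
  rewrite integral_mkcond; apply: eq_integral => x _; rewrite patchE /= indicE.
  by case: ifPn => _; rewrite ?mulr1 ?mulr0 ?normr0.
have lebu := lebesgue_differentiation locu.
(* The pairs [(y, s)] with [s] between [- y] and [v - y]. *)
pose D : set (R * R) := [set p | `|p.2 - (v - p.1 + - p.1) / 2| <= `|v| / 2].
pose F (p : R * R) : \bar R := ((h p.2 ^+ 2) * \1_D p)%:E.
have mD : measurable D.
  have mg : measurable_fun setT (fun p : R * R => `|p.2 - (v - p.1 + - p.1) / 2|).
    apply: measurableT_comp => //; apply: measurable_funB => //.
    apply: measurable_funM => //; apply: measurable_funD.
      exact: measurable_funB.
    exact: measurableT_comp.
  have := mg measurableT _ (measurable_itv `]-oo, `|v| / 2]).
  by rewrite setTI; congr measurable; apply/seteqP; split=> p /=; rewrite in_itv.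
have mF : measurable_fun setT F.
  apply/measurable_EFinP; apply: measurable_funM => //.
  by apply: measurable_funX; apply: measurableT_comp => //; exact: measurable_snd.
have F0 p : (0 <= F p)%E by rewrite lee_fin mulr_ge0// sqr_ge0.
have inner y : (\int[mu]_(s in between (- y) (v - y)) (h s ^+ 2)%:E
    = \int[mu]_s F (y, s))%E.
  rewrite integral_mkcond; apply: eq_integral => s _; rewrite patchE /F /= indicE.
  rewrite (_ : ((y, s) \in D) = (s \in between (- y) (v - y))).
    by case: ifPn => _; rewrite ?mulr1 ?mulr0.
  apply/idP/idP; rewrite !inE /D/= /between/= opprK subrK [- y + _]addrC//.
have outer s : (\int[mu]_y F (y, s) = (h s ^+ 2)%:E * `|v|%:E)%E.
  transitivity (\int[mu]_y ((h s ^+ 2)%:E * (\1_D (y, s))%:E))%E.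
    by apply: eq_integral => y _; rewrite -EFinM.
  rewrite ge0_integralZl ?lee_fin ?sqr_ge0//; last first.
    apply/measurable_EFinP;
    apply: (@measurableT_comp _ _ _ _ _ _ (\1_D : R * R -> R) _
      (fun y : R => (y, s))) => //.
  congr (_ * _)%E.
  rewrite (_ : (fun y => _) =
    (fun y => (\1_(`[v / 2 - s - `|v| / 2, v / 2 - s + `|v| / 2]%classic
      : set R) y)%:E)).
    rewrite integral_indic// setIT /= lebesgue_measure_itv/= lte_fin.
    have [v0|v0] := eqVneq v 0; first by rewrite v0 normr0 ifF// mul0r addr0 subr0 ltxx.
    rewrite ifT; first by rewrite -EFinB; congr EFin; field.
    by have : 0 < `|v| by [rewrite normr_gt0]; lra.
  apply/funext => y; rewrite !indicE; congr ((nat_of_bool _)%:R%:E); apply/idP/idP;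
    rewrite !inE /D/= in_itv/= ler_norml => /andP[? ?]; apply/andP; split; lra.
apply: (@le_trans _ _ (\int[mu]_y (`|v|%:E * \int[mu]_s F (y, s)))%E).
  apply: ae_ge0_le_integral => //.
  - by move=> y _; rewrite lee_fin sqr_ge0.
  - apply: measurable_sqr_EFin; exact: (Lfun2_measurable (Lfun2_translation_diff v u2)).
  - by move=> y _; rewrite mule_ge0 ?lee_fin// integral_ge0.
  - apply: emeasurable_funM => //.
    exact: (@measurable_fun_fubini_tonelli_F _ _ _ _ _ mu F).
  - apply: (@filterS2 _ _ (ae_filter_ringOfSetsType mu) _ _ _ _
      (ae_reflect 0 lebu) (ae_reflect v lebu)) => y.
    rewrite sub0r => ly lvy _.
    have := increment_sqr_le u2 h2 uh ly lvy.
    by rewrite inner opprK subrK.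
rewrite ge0_integralZl//; last first.
- by move=> y _; exact: integral_ge0.
- exact: (@measurable_fun_fubini_tonelli_F _ _ _ _ _ mu F).
rewrite fubini_tonelli//.
under eq_integral do rewrite outer.
rewrite ge0_integralZr//; last 2 first.
- exact: measurable_sqr_EFin.
- by move=> s _; rewrite lee_fin sqr_ge0.
by rewrite muleCA -EFinM -expr2 real_normK ?num_real// muleC.
Qed.

End Translation.

(** * The operator on real-valued functions *)

Section RealOperator.
Context {R : realType}.
Local Notation mu := (@lebesgue_measure R).
Implicit Types (u h f : R -> R) (v : R).

Lemma measurable_invr : measurable_fun setT (fun x : R => x^-1).
Proof.
rewrite -(setUv [set (0:R)]); apply/measurable_funU => //.
  exact: measurableC.
split; first exact: measurable_fun_set1.
apply: open_continuous_measurable_fun.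
  by apply: closed_openC; exact: closed_eq.
by move=> x; rewrite inE/= => /eqP x0; exact: inv_continuous.
Qed.

(** Tonelli's theorem makes the section integrals of the positive and of the
    negative part measurable. *)
Lemma measurable_Rintegral_section (G : R * R -> R) : measurable_fun setT G ->
  measurable_fun setT (fun v => \int[mu]_y G (v, y)).
Proof.
move=> mG; apply: measurableT_comp; first exact: fine_measurable.
have mE : measurable_fun setT (EFin \o G) by exact/measurable_EFinP.
rewrite (_ : (fun v => _) = (fun v => \int[mu]_y ((EFin \o G)^\+ (v, y))) \-
    (fun v => \int[mu]_y ((EFin \o G)^\- (v, y))))%E; last first.
  by apply/funext => v; rewrite integralE; congr (_ - _)%E; apply: eq_integral => y _;
    rewrite ?funeposE ?funenegE.
apply: emeasurable_funB.
- exact: (@measurable_fun_fubini_tonelli_F _ _ _ _ _ mu _ (measurable_funepos mE)).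
- exact: (@measurable_fun_fubini_tonelli_F _ _ _ _ _ mu _ (measurable_funeneg mE)).
Qed.

Definition quotient_kernel u v (y : R) : R := translation_diff u v y / v.

Lemma sqnormZr f (c : R) : measurable_fun setT f ->
  sqnorm (fun y => f y * c) = ((c ^+ 2)%:E * sqnorm f)%E.
Proof.
move=> mf; rewrite -ge0_integralZl//; last 3 first.
- exact: measurable_sqr_EFin.
- by move=> y _; rewrite lee_fin sqr_ge0.
- by rewrite lee_fin sqr_ge0.
by apply: eq_integral => y _; rewrite -EFinM exprMn mulrC.
Qed.

Lemma Lfun2_quotient_kernel u v : u \in Lfun mu 2%:E ->
  quotient_kernel u v \in Lfun mu 2%:E.
Proof.
move=> u2; have k2 := Lfun2_translation_diff v u2; have mk := Lfun2_measurable k2.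
apply/Lfun2P; split; first exact: measurable_funM.
by rewrite (sqnormZr _ mk) (Lfun2_sqnorm k2) -EFinM ltry.
Qed.

Definition kernel_constant u h : R := 4 * fine (sqnorm u) + fine (sqnorm h).

Lemma kernel_constant_ge0 u h : 0 <= kernel_constant u h.
Proof. by rewrite addr_ge0// ?mulr_ge0// fine_ge0// sqnorm_ge0. Qed.

(** For [v] nonzero, the left side multiplied by [1 + v^2] is the sum of
    [N / v^2] and [N], with [N] the squared norm of the translation difference;
    each of the two bounds on [N] handles one term.  For [v = 0] the kernel
    vanishes because [0^-1 = 0]. *)
Lemma sqnorm_quotient_kernel u h v :
  u \in Lfun mu 2%:E -> h \in Lfun mu 2%:E -> real_weak_derivative u h ->
  (sqnorm (quotient_kernel u v) <= (kernel_constant u h * (oneDsqr v)^-1)%:E)%E.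
Proof.
move=> u2 h2 uh; have k2 := Lfun2_translation_diff v u2.
have := sqnorm_translation_diff_le v u2.
have := sqnorm_translation_diff_weak v u2 h2 uh.
rewrite (sqnormZr _ (Lfun2_measurable k2)).
rewrite (Lfun2_sqnorm k2) (Lfun2_sqnorm u2) (Lfun2_sqnorm h2) -!EFinM !lee_fin.
have := kernel_constant_ge0 u h; rewrite /kernel_constant.
set N := fine (sqnorm (translation_diff u v)).
set A := fine (sqnorm u); set B := fine (sqnorm h) => C0 NB NA.
have d0 : 0 < oneDsqr v by rewrite (lt_le_trans ltr01)// oneDsqr_ge1.
rewrite ler_pdivlMr//; have [->|v0] := eqVneq v 0.
  by rewrite invr0 expr0n mulr0n !mul0r.
have v20 : 0 < v ^+ 2 by rewrite exprn_even_gt0.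
rewrite exprVn /oneDsqr mulrDr mulr1 addrC [_^-1 * N]mulrC divfK ?gt_eqF//.
by rewrite lerD// ler_pdivrMr// mulrC.
Qed.

Definition real_wigner_op u f v : R := \int[mu]_y (quotient_kernel u v y * f y).

Lemma measurable_real_wigner_op u f : measurable_fun setT u ->
  measurable_fun setT f -> measurable_fun setT (real_wigner_op u f).
Proof.
move=> mu_ mf.
apply: (@measurable_Rintegral_section (fun p => quotient_kernel u p.1 p.2 * f p.2)).
have msnd : measurable_fun setT (snd : R * R -> R) by exact: measurable_snd.
have mfst : measurable_fun setT (fst : R * R -> R) by exact: measurable_fst.
apply: measurable_funM; last exact: measurableT_comp.
apply: measurable_funM; last by apply: measurableT_comp => //; exact: measurable_invr.
apply: measurable_funB; apply: measurableT_comp => //; last exact: measurableT_comp.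
exact: measurable_funB.
Qed.

Lemma real_wigner_op_sqr_le u h f v :
  u \in Lfun mu 2%:E -> h \in Lfun mu 2%:E -> real_weak_derivative u h ->
  f \in Lfun mu 2%:E ->
  real_wigner_op u f v ^+ 2 <=
    kernel_constant u h * fine (sqnorm f) * (oneDsqr v)^-1.
Proof.
move=> u2 h2 uh f2; rewrite -lee_fin.
apply: le_trans (cauchy_schwarz_Lfun2 (Lfun2_quotient_kernel v u2) f2) _.
rewrite mulrAC EFinM -(Lfun2_sqnorm f2) lee_wpmul2r ?sqnorm_ge0//.
exact: sqnorm_quotient_kernel.
Qed.

Lemma integral_oneDsqrV : (\int[mu]_x ((oneDsqr x)^-1)%:E = (pi : R)%:E)%E.
Proof.
rewrite ge0_symfun_integralT.
- rewrite -set_itvcy integral0y_oneDsqr -EFinM; congr EFin.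
  by rewrite mulrC divfK.
- by move=> x; rewrite invr_ge0 (le_trans ler01)// oneDsqr_ge1.
- exact: continuous_oneDsqrV.
- by move=> x /=; rewrite /oneDsqr sqrrN.
Qed.

Lemma sqnorm_real_wigner_op u h f :
  u \in Lfun mu 2%:E -> h \in Lfun mu 2%:E -> real_weak_derivative u h ->
  f \in Lfun mu 2%:E ->
  (sqnorm (real_wigner_op u f) <=
    (kernel_constant u h * fine (sqnorm f) * pi)%:E)%E.
Proof.
move=> u2 h2 uh f2; rewrite [leRHS]EFinM -integral_oneDsqrV.
have C0 : 0 <= kernel_constant u h * fine (sqnorm f).
  by rewrite mulr_ge0 ?kernel_constant_ge0// fine_ge0// sqnorm_ge0.
have P0 (x : R) : 0 <= (oneDsqr x)^-1.
  by rewrite invr_ge0 (le_trans ler01)// oneDsqr_ge1.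
have mP : measurable_fun setT (fun x : R => (oneDsqr x)^-1).
  by apply: continuous_measurable_fun; exact: continuous_oneDsqrV.
have mPE : measurable_fun setT (EFin \o (fun x : R => (oneDsqr x)^-1)).
  exact/measurable_EFinP.
rewrite -ge0_integralZl//.
apply: ge0_le_integral => //.
- by move=> x _; rewrite lee_fin sqr_ge0.
- by apply: measurable_sqr_EFin; apply: measurable_real_wigner_op; exact: Lfun2_measurable.
- exact: emeasurable_funM.
- by move=> v _; rewrite -EFinM lee_fin; exact: real_wigner_op_sqr_le.
Qed.

Lemma Lfun2_real_wigner_op u h f :
  u \in Lfun mu 2%:E -> h \in Lfun mu 2%:E -> real_weak_derivative u h ->
  f \in Lfun mu 2%:E -> real_wigner_op u f \in Lfun mu 2%:E.
Proof.
move=> u2 h2 uh f2; apply: (Lfun2_le _ (sqnorm_real_wigner_op u2 h2 uh f2)) => //.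
  by apply: measurable_real_wigner_op; exact: Lfun2_measurable.
by rewrite ltry.
Qed.

End RealOperator.

(** * The operator on complex-valued functions *)

Section ComplexOperator.
Context {R : realType}.
Local Notation mu := (@lebesgue_measure R).
Implicit Types (w f g F G : R -> R[i]) (v : R).

Lemma wigner_integrandE w f v y : wigner_integrand w f v y =
  (quotient_kernel (re_part w) v y * re_part f y
    - quotient_kernel (im_part w) v y * im_part f y) +i*
  (quotient_kernel (re_part w) v y * im_part f y
    + quotient_kernel (im_part w) v y * re_part f y).
Proof.
rewrite /wigner_integrand /quotient_kernel /translation_diff /re_part /im_part.
rewrite -fmorphV /=; case: (w _) => a b; case: (w _) => c d; case: (f y) => p q /=.
by congr (_ +i* _); ring.
Qed.

(** For every [v], each of the four products has two square-integrable factors;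
    so the integral converges for all [v], not merely almost all. *)
Lemma cintegral_wigner_integrand w f v : inL2 w -> inL2 f ->
  cintegrable (wigner_integrand w f v) /\
  wigner_op w f v =
    (real_wigner_op (re_part w) (re_part f) v
      - real_wigner_op (im_part w) (im_part f) v) +i*
    (real_wigner_op (re_part w) (im_part f) v
      + real_wigner_op (im_part w) (re_part f) v).
Proof.
move=> [w1 w2] [f1 f2].
have k1 := Lfun2_quotient_kernel v w1; have k2 := Lfun2_quotient_kernel v w2.
have reE : re_part (wigner_integrand w f v) = fun y =>
    quotient_kernel (re_part w) v y * re_part f y
    - quotient_kernel (im_part w) v y * im_part f y.
  by apply/funext => y; rewrite /re_part wigner_integrandE.
have imE : im_part (wigner_integrand w f v) = fun y =>
    quotient_kernel (re_part w) v y * im_part f y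
    + quotient_kernel (im_part w) v y * re_part f y.
  by apply/funext => y; rewrite /im_part wigner_integrandE.
have i11 := Lfun2_mul_integrable k1 f1; have i22 := Lfun2_mul_integrable k2 f2.
have i12 := Lfun2_mul_integrable k1 f2; have i21 := Lfun2_mul_integrable k2 f1.
split; rewrite /wigner_op ?/cintegral ?/cintegrable reE imE.
- split; first exact: (integrableB measurableT i11 i22).
  exact: (integrableD measurableT i12 i21).
- by rewrite RintegralB// RintegralD.
Qed.

Lemma cintegral_linear (a : R[i]) F G : cintegrable F -> cintegrable G ->
  cintegral (fun y => a * F y + G y) = a * cintegral F + cintegral G.
Proof.
move=> [F1 F2] [G1 G2]; case: a => p q.
have Z r (H : R -> R) : mu.-integrable setT (EFin \o H) ->
    mu.-integrable setT (EFin \o (fun y => r * H y)).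
  by move=> iH; apply: (integrableZl measurableT r iH).
rewrite /cintegral.
have -> : re_part (fun y => (p +i* q) * F y + G y) =
    fun y => (p * re_part F y - q * im_part F y) + re_part G y.
  by apply/funext => y; rewrite /re_part /im_part; case: (F y) (G y) => [? ?] [? ?].
have -> : im_part (fun y => (p +i* q) * F y + G y) =
    fun y => (p * im_part F y + q * re_part F y) + im_part G y.
  by apply/funext => y; rewrite /re_part /im_part; case: (F y) (G y) => [? ?] [? ?].
have iB := integrableB measurableT (Z p _ F1) (Z q _ F2).
have iD := integrableD measurableT (Z p _ F2) (Z q _ F1).
rewrite (RintegralD measurableT iB G1) (RintegralD measurableT iD G2).
rewrite (RintegralB measurableT (Z p _ F1) (Z q _ F2)).
rewrite (RintegralD measurableT (Z p _ F2) (Z q _ F1)).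
by rewrite !RintegralZl.
Qed.

Lemma L2norm_sqnorm f : measurable_fun setT (re_part f) ->
  measurable_fun setT (im_part f) ->
  L2norm f = ((sqnorm (re_part f) + sqnorm (im_part f)) `^ 2^-1)%E.
Proof.
move=> mre mim; rewrite /L2norm unlock; congr (_ `^ _)%E.
rewrite -ge0_integralD//; last 4 first.
- by move=> x _; rewrite lee_fin sqr_ge0.
- exact: measurable_sqr_EFin.
- by move=> x _; rewrite lee_fin sqr_ge0.
- exact: measurable_sqr_EFin.
apply: eq_integral => x _ /=.
have c0 : 0 <= cnorm (f x) by exact: sqrtr_ge0.
rewrite (ger0_norm c0) powR_mulrn// sqr_sqrtr//.
by rewrite addr_ge0// sqr_ge0.
Qed.

Lemma inL2_measurable f : inL2 f ->
  measurable_fun setT (re_part f) /\ measurable_fun setT (im_part f).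
Proof. by move=> [f1 f2]; split; exact: Lfun2_measurable. Qed.

Lemma wigner_op_ae_eq w f g v : inL2 w -> inL2 f -> inL2 g ->
  {ae mu, forall y, f y = g y} -> wigner_op w f v = wigner_op w g v.
Proof.
move=> w2 f2 g2 fg.
have [if_ _] := cintegral_wigner_integrand v w2 f2.
have [ig _] := cintegral_wigner_integrand v w2 g2.
case: if_ ig => [/integrableP[mf1 _] /integrableP[mf2 _]]
  [/integrableP[mg1 _] /integrableP[mg2 _]].
by rewrite /wigner_op /cintegral; congr (_ +i* _); congr fine; apply: ae_eq_integral => //;
  apply: (@filterS _ _ (ae_filter_ringOfSetsType mu) _ _ _ fg) => y fgy _;
  rewrite /= /re_part /im_part /wigner_integrand fgy.
Qed.

Lemma wigner_op_linear w (a : R[i]) f g v : inL2 w -> inL2 f -> inL2 g ->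
  wigner_op w (fun y => a * f y + g y) v = a * wigner_op w f v + wigner_op w g v.
Proof.
move=> w2 f2 g2.
have [if_ _] := cintegral_wigner_integrand v w2 f2.
have [ig _] := cintegral_wigner_integrand v w2 g2.
rewrite /wigner_op -cintegral_linear//; congr cintegral; apply/funext => y.
by rewrite /wigner_integrand; ring.
Qed.

Lemma sum_bounds (C1 C2 F1 F2 p : R) (t11 t12 t21 t22 : \bar R) :
  (t11 <= (C1 * F1 * p)%:E)%E -> (t12 <= (C1 * F2 * p)%:E)%E ->
  (t21 <= (C2 * F1 * p)%:E)%E -> (t22 <= (C2 * F2 * p)%:E)%E ->
  (2%:E * t11 + 2%:E * t22 + (2%:E * t12 + 2%:E * t21) <=
    (2 * p * (C1 + C2))%:E * (F1%:E + F2%:E))%E.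
Proof.
move=> h11 h12 h21 h22.
have -> : ((2 * p * (C1 + C2))%:E * (F1%:E + F2%:E) =
  2%:E * (C1 * F1 * p)%:E + 2%:E * (C2 * F2 * p)%:E +
  (2%:E * (C1 * F2 * p)%:E + 2%:E * (C2 * F1 * p)%:E))%E.
  by rewrite -!EFinM -!EFinD; congr EFin; ring.
by rewrite !leeD// lee_wpmul2l// lee_fin.
Qed.

(** The constant is [sqrt (2 pi (C1 + C2))], where [C1] and [C2] are the kernel
    constants of the real and the imaginary part of [w]. *)
Lemma wigner_op_bounded w : inH1 w -> exists K : R, forall f, inL2 f ->
  inL2 (wigner_op w f) /\ (L2norm (wigner_op w f) <= K%:E * L2norm f)%E.
Proof.
move=> [w2 [g g2 wg]]; have [wg1 wg2] := weak_derivative_real wg.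
pose C1 := kernel_constant (re_part w) (re_part g).
pose C2 := kernel_constant (im_part w) (im_part g).
have C10 : 0 <= C1 by exact: kernel_constant_ge0.
have C20 : 0 <= C2 by exact: kernel_constant_ge0.
pose L : R := 2 * pi * (C1 + C2).
have L0 : 0 <= L by rewrite !mulr_ge0 ?pi_ge0// addr_ge0.
exists (Num.sqrt L).
move=> f f2; case: (w2) => w21 w22; case: (g2) => g21 g22; case: (f2) => f21 f22.
have T11 := Lfun2_real_wigner_op w21 g21 wg1 f21.
have T12 := Lfun2_real_wigner_op w21 g21 wg1 f22.
have T21 := Lfun2_real_wigner_op w22 g22 wg2 f21.
have T22 := Lfun2_real_wigner_op w22 g22 wg2 f22.
have reE : re_part (wigner_op w f) = fun v =>
    real_wigner_op (re_part w) (re_part f) v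
      + - real_wigner_op (im_part w) (im_part f) v.
  by apply/funext => v; have [_] := cintegral_wigner_integrand v w2 f2;
    rewrite /re_part => ->.
have imE : im_part (wigner_op w f) = fun v =>
    real_wigner_op (re_part w) (im_part f) v
      + real_wigner_op (im_part w) (re_part f) v.
  by apply/funext => v; have [_] := cintegral_wigner_integrand v w2 f2;
    rewrite /im_part => ->.
have B2 : inL2 (wigner_op w f).
  by split; rewrite ?reE ?imE; apply: Lfun2D => //; exact: Lfun2N.
split=> //.
have [mB1 mB2] := inL2_measurable B2; have [mf1 mf2] := inL2_measurable f2.
rewrite !L2norm_sqnorm//.
have -> : (Num.sqrt L)%:E = (L%:E `^ 2^-1)%E.
  by rewrite poweR_EFin powR12_sqrt.
have LE0 : (0 <= L%:E)%E by rewrite lee_fin.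
have S0 (a b : R -> R) : (0 <= sqnorm a + sqnorm b)%E.
  by apply: adde_ge0; exact: sqnorm_ge0.
rewrite -(poweRM _ LE0 (S0 _ _)).
have in0y (X : \bar R) : (0 <= X)%E -> X \in `[0%E, +oo%E].
  by move=> X0; rewrite in_itv/= X0 leey.
apply: gt0_ler_poweR; first by rewrite invr_ge0.
- exact: in0y (S0 _ _).
- exact: in0y (mule_ge0 LE0 (S0 _ _)).
rewrite reE imE.
have mN := Lfun2_measurable (Lfun2N T22).
apply: le_trans (leeD (sqnormD_le (Lfun2_measurable T11) mN)
  (sqnormD_le (Lfun2_measurable T12) (Lfun2_measurable T21))) _.
rewrite sqnormN.
rewrite [X in (_ <= _ * (X + _))%E](Lfun2_sqnorm f21).
rewrite [X in (_ <= _ * (_ + X))%E](Lfun2_sqnorm f22).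
by apply: sum_bounds; exact: sqnorm_real_wigner_op.
Qed.

End ComplexOperator.

Unset Implicit Arguments.
Theorem theorem1 (R : realType) (V : R -> R) (l : R)
    (DV : R -> (R -> R[i]) -> R[i]) (Vw : R -> R -> R[i]) :
  measurable_fun setT V ->
  0 < l ->
  (forall x : R, x \in `[- (l / 2), l / 2] ->
     defines_tempered (potential_difference V x) (DV x)) ->
  (forall x : R, x \in `[- (l / 2), l / 2] ->
     dist_is_function (wigner_potential (DV x)) (Vw x) /\ inH1 (Vw x)) ->
  forall x : R, x \in `[- (l / 2), l / 2] ->
    (forall f : R -> R[i], inL2 f ->
       {ae (@lebesgue_measure R), forall v : R,
          cintegrable (wigner_integrand (Vw x) f v)}) /\
    bounded_linear_L2 (wigner_op (Vw x)).
Proof.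
move=> _ _ _ Vw_H1 x /Vw_H1[_ w1]; have w2 := w1.1.
have [K boundedK] := wigner_op_bounded w1.
split=> [f f2|].
  by apply: aeW => v; have [] := cintegral_wigner_integrand v w2 f2.
split=> [f /boundedK[]//|f g f2 g2 fg|a f g f2 g2|].
- by apply: aeW => v; exact: wigner_op_ae_eq.
- by apply: aeW => v; exact: wigner_op_linear.
- by exists K => f /boundedK[].
Qed.
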